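(* Let $G$ be the grid graph $G=P_r\Box P_t$, with $r\ge t\ge 2$. Then $edim(G)=dim(G)=2$.
   Context: All graphs are finite and simple. $P_n$ denotes the path with $n$ vertices. The Cartesian product $G\Box H$ has vertex set $V(G)\times V(H)$, with $(a,b)$ and $(c,d)$ adjacent if and only if either $a=c$ and $bd\in E(H)$, or $b=d$ and $ac\in E(G)$. For a connected graph $G=(V,E)$, $d_G(x,y)$ is the length of a shortest path between vertices $x,y$. A vertex $v$ distinguishes two vertices $x,y$ if $d_G(v,x)\neq d_G(v,y)$. A set $S\subseteq V$ is a metric generator for $G$ if any two distinct vertices of $G$ are distinguished by some element of $S$; the metric dimension $dim(G)$ is the minimum cardinality of a metric generator. The distance between a vertex $v$ and an edge $e=uw$ is $d_G(e,v)=\min\{d_G(u,v),d_G(w,v)\}$. A vertex $w$ distinguishes two edges $e_1,e_2$ if $d_G(w,e_1)\ne d_G(w,e_2)$. A set $S\subseteq V$ is an edge metric generator for $G$ if every two distinct edges of $G$ are distinguished by some vertex of $S$; the edge metric dimension $edim(G)$ is the smallest cardinality of an edge metric generator for $G$. *)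

(* Defs.v *)
From mathcomp Require Import all_boot.

Set Implicit Arguments.
Unset Strict Implicit.
Unset Printing Implicit Defensive.

Record sgraph := SGraph {
  vertex :> finType;
  adj : rel vertex;
  adj_sym : symmetric adj;
  adj_irrefl : irreflexive adj
}.

Definition path_adj (n : nat) : rel 'I_n :=
  fun i j => (i.+1 == j :> nat) || (j.+1 == i :> nat).

Lemma path_adj_sym n : symmetric (@path_adj n).
Proof. by move=> i j; rewrite /path_adj orbC. Qed.

Lemma path_adj_irrefl n : irreflexive (@path_adj n).
Proof. by move=> i; rewrite /path_adj orbb gtn_eqF. Qed.

Definition path_graph (n : nat) : sgraph :=
  SGraph (@path_adj_sym n) (@path_adj_irrefl n).

Definition cart_adj (G H : sgraph) : rel (G * H) :=
  fun u v => ((u.1 == v.1) && adj u.2 v.2) || ((u.2 == v.2) && adj u.1 v.1).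

Lemma cart_adj_sym (G H : sgraph) : symmetric (@cart_adj G H).
Proof.
move=> u v; rewrite /cart_adj (eq_sym u.1) (eq_sym u.2).
by rewrite (adj_sym u.1) (adj_sym u.2).
Qed.

Lemma cart_adj_irrefl (G H : sgraph) : irreflexive (@cart_adj G H).
Proof. by move=> u; rewrite /cart_adj !adj_irrefl !andbF. Qed.

Definition cart_prod (G H : sgraph) : sgraph :=
  SGraph (@cart_adj_sym G H) (@cart_adj_irrefl G H).

Section Metric.
Variable G : sgraph.

(* The path is x :: p, with n edges. *)
Definition has_path (x y : G) (n : nat) : bool :=
  [exists p : n.-tuple G, [&& path (@adj G) x p, uniq (x :: p) & last x p == y]].

(* A path has fewer than #|G| edges, so for connected vertices the search
   finds the shortest length; it returns #|G| if there is no path. *)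
Definition dist (x y : G) : nat := find (has_path x y) (iota 0 #|G|).

Definition edges : {set {set G}} :=
  [set [set x; y] | x in [set: G], y in [set: G] & adj x y].

(* The neutral element #|G| bounds every value of dist, so for a nonempty e
   this is the minimum of dist u v over the u in e. *)
Definition edge_dist (e : {set G}) (v : G) : nat :=
  \big[minn/#|G|]_(u in e) dist u v.

Definition metric_generator (S : {set G}) : bool :=
  [forall x, forall y, (x != y) ==> [exists v in S, dist v x != dist v y]].

Definition edge_metric_generator (S : {set G}) : bool :=
  [forall e1 in edges, forall e2 in edges,
    (e1 != e2) ==> [exists v in S, edge_dist e1 v != edge_dist e2 v]].

(* [set: G] is always a generator of both kinds, as required by arg min. *)
Definition metric_dim : nat :=
  #|[arg min_(S < [set: G] | metric_generator S) #|S|]|.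

Definition edge_metric_dim : nat :=
  #|[arg min_(S < [set: G] | edge_metric_generator S) #|S|]|.

End Metric.

(* Main.v *)
Require Import Defs.
From mathcomp Require Import all_boot.
From mathcomp Require Import zify.
From HB Require Import structures.

(** Put coordinates (i, j) on the vertices of the grid, with 0 <= i < r and
    0 <= j < t. Distance is the taxicab distance ([grid_dist]), so the corners
    (0, 0) and (0, t - 1) see the vertex (i, j) at distances i + j and
    i + (t - 1 - j). Their sum 2 i + t - 1 gives i, then the first of them
    gives j, so these two corners distinguish all vertices.

    They distinguish edges too. The edge from (i, j) to (i + 1, j) is at
    distances i + j and i + (t - 1 - j), the edge from (i, j) to (i, j + 1) is
    at distances i + j and i + (t - 1 - (j + 1)). The sums are 2 i + t - 1 and
    2 i + t - 2: their parity tells the direction of the edge, and the values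
    then give i and j ([corner_edge_dist], [grid_corners_edge_metric]).

    One vertex never suffices. As r and t are at least 2, every vertex v has
    two neighbours x and y; both are at distance 1 from v, and the edges vx and
    vy are both at distance 0 from v. Since the generators form an upward
    closed family of sets, excluding the singletons excludes every set with at
    most one element ([card_arg_min2]).

    The taxicab formula comes from a local criterion: a function that vanishes
    at y, grows by at most 1 along an edge, and can be decreased by 1 along
    some edge away from y is the distance to y ([dist_potential]). Functions of
    this kind add up in a Cartesian product ([cart_potential]), which reduces
    the grid to the path. *)

Set Implicit Arguments.
Unset Strict Implicit.
Unset Printing Implicit Defensive.

(** * Distances in a graph *)

(* Lets the minimum defining the distance to an edge be reordered. *)
HB.instance Definition _ := SemiGroup.isComLaw.Build nat minn minnA minnC.

Section Distance.
Variable G : sgraph.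
Implicit Types (x y v : G) (f : G -> nat).

Lemma adj_neq x y : adj x y -> x != y.
Proof. by apply: contraTneq => ->; rewrite adj_irrefl. Qed.

Lemma has_pathP x y n :
  reflect (exists p : seq G,
             [/\ size p = n, path (@adj G) x p, uniq (x :: p) & last x p = y])
          (has_path x y n).
Proof.
apply: (iffP existsP) => [[p /and3P[pp up /eqP lp]]|[p [sp pp up lp]]].
  by exists p; rewrite size_tuple.
have sp' : size p == n by rewrite sp.
by exists (Tuple sp'); apply/and3P; split => //; apply/eqP.
Qed.

Lemma has_path_lt_card x y n : has_path x y n -> n < #|G|.
Proof.
case/has_pathP=> p [<- _ up _].
by rewrite -[(size p).+1]/(size (x :: p)) -(card_uniqP up) max_card.
Qed.

Lemma dist_eq x y n :
  has_path x y n -> (forall m, has_path x y m -> n <= m) -> dist x y = n.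
Proof.
move=> pn min_n; have n_lt := has_path_lt_card pn.
rewrite /dist; set s := iota _ _.
have hs : has (has_path x y) s by apply/hasP; exists n => //; rewrite mem_iota.
have find_lt : find (has_path x y) s < #|G|.
  by rewrite -[X in _ < X](size_iota 0) -has_find.
have := nth_find 0 hs; rewrite nth_iota // add0n => /min_n n_le.
apply/eqP; rewrite eqn_leq n_le andbT leqNgt; apply/negP => lt_find.
by have := before_find 0 lt_find; rewrite nth_iota // add0n pn.
Qed.

Lemma dist_refl x : dist x x = 0.
Proof. by apply: dist_eq => //; apply/has_pathP; exists [::]. Qed.

Lemma dist_adj x y : adj x y -> dist x y = 1.
Proof.
move=> xy; apply: dist_eq => [|[|m] //].
  by apply/has_pathP; exists [:: y]; rewrite /= inE xy adj_neq.
case/has_pathP=> -[|z p] [//= _ _ _ eq_xy].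
by rewrite eq_xy adj_irrefl in xy.
Qed.

Lemma dist_le_card x y : dist x y <= #|G|.
Proof. by rewrite -[X in _ <= X](size_iota 0) find_size. Qed.

Lemma edge_dist_pair x y v :
  x != y -> edge_dist [set x; y] v = minn (dist x v) (dist y v).
Proof.
move=> xy; rewrite /edge_dist -big_enum /=.
have perm_xy : perm_eq (enum [set x; y]) [:: x; y].
  apply: uniq_perm; rewrite ?enum_uniq //= ?inE ?xy // => z.
  by rewrite mem_enum !inE.
by rewrite (perm_big _ perm_xy) /= !big_cons big_nil (minn_idPl (dist_le_card y v)).
Qed.

Lemma mem_edges x y : adj x y -> [set x; y] \in edges G.
Proof. by move=> xy; apply/imset2P; exists x y; rewrite ?inE. Qed.

(** These local conditions characterise the distance to [y]: the Lipschitz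
    condition makes [f] a lower bound for the length of every path to [y], and
    the descent condition yields a path of length exactly [f x]. *)
Definition distance_potential y f :=
  [/\ f y = 0,
      forall x z, adj x z -> f x <= (f z).+1 &
      forall x, x != y -> exists2 z, adj x z & f x = (f z).+1].

Lemma potential_path_le f x p :
    (forall x z, adj x z -> f x <= (f z).+1) ->
  path (@adj G) x p -> f x <= f (last x p) + size p.
Proof.
move=> lip; elim: p x => [|z p IHp] x /=; first by rewrite addn0.
case/andP=> /lip xz /IHp; lia.
Qed.

(** Following decreasing neighbours from [x] leads to [y]. Since [f] is strictly
    decreasing along this walk, it does not repeat a vertex; the bound on [f]
    over the tail is what carries this through the induction. *)
Lemma potential_descent y f x : distance_potential y f ->
  exists p, [/\ size p = f x, path (@adj G) x p, uniq (x :: p),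
                last x p = y & forall u, u \in p -> f u < f x].
Proof.
case=> fy _ desc; move fx: (f x) => n; elim: n x fx => [|n IHn] x fx.
  exists [::]; split=> //=; apply/eqP; apply: contraTT isT => /desc[z _].
  by rewrite fx.
have /desc[z xz] : x != y by apply: contra_eq_neq fx => ->; rewrite fy.
rewrite fx => -[/esym fz]; have [p [sp pp up lp lt_p]] := IHn z fz.
have lt_zp u : u \in z :: p -> f u < n.+1.
  by rewrite inE => /predU1P[->|/lt_p]; [rewrite fz | apply: leqW].
exists (z :: p); split=> //; rewrite ?[size _]/= ?sp ?[path _ _ _]/= ?xz //.
by rewrite cons_uniq up andbT; apply/negP => /lt_zp; rewrite fx ltnn.
Qed.

Lemma dist_potential y f x : distance_potential y f -> dist x y = f x.
Proof.
move=> pot; apply: dist_eq => [|m /has_pathP[p [<- pp _ lp]]].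
  have [p [sp pp up lp _]] := potential_descent x pot.
  by apply/has_pathP; exists p.
case: pot => fy lip _; have := potential_path_le lip pp.
by rewrite lp fy.
Qed.

End Distance.

(** * Metric generators and edge metric generators *)

Section Generators.
Variable G : sgraph.
Implicit Types (S T : {set G}) (x y v : G).

Lemma metric_generatorP S :
  reflect (forall x y, x != y -> exists2 v, v \in S & dist v x != dist v y)
          (metric_generator S).
Proof.
apply: (iffP 'forall_forallP) => gen x y.
  by move=> xy; apply/exists_inP; apply: (implyP (gen x y)).
by apply/implyP => /gen/exists_inP.
Qed.

Lemma edge_metric_generatorP S :
  reflect {in edges G &, forall e1 e2, e1 != e2 ->
             exists2 v, v \in S & edge_dist e1 v != edge_dist e2 v}
          (edge_metric_generator S).
Proof.
apply: (iffP forall_inP) => gen.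
  move=> e1 e2 e1G e2G e12; apply/exists_inP.
  exact: (implyP (forall_inP (gen _ e1G) _ e2G)).
move=> e1 e1G; apply/forall_inP => e2 e2G; apply/implyP => e12.
exact/exists_inP/gen.
Qed.

Lemma metric_generatorS S T :
  S \subset T -> metric_generator S -> metric_generator T.
Proof.
move=> /subsetP sST /metric_generatorP gen; apply/metric_generatorP => x y.
by case/gen=> v /sST; exists v.
Qed.

Lemma edge_metric_generatorS S T :
  S \subset T -> edge_metric_generator S -> edge_metric_generator T.
Proof.
move=> /subsetP sST /edge_metric_generatorP gen.
apply/edge_metric_generatorP => e1 e2 e1G e2G.
by case/gen=> // v /sST; exists v.
Qed.

Lemma metric_generator_pair a b :
    (forall x y, dist a x = dist a y -> dist b x = dist b y -> x = y) ->
  metric_generator [set a; b].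
Proof.
move=> sep; apply/metric_generatorP => x y xy.
have [eq_a|neq_a] := eqVneq (dist a x) (dist a y); last first.
  by exists a; rewrite ?set21.
exists b; rewrite ?set22 //; apply: contraNneq xy => eq_b.
by apply/eqP/sep.
Qed.

Lemma edge_metric_generator_pair a b :
    {in edges G &, forall e1 e2, edge_dist e1 a = edge_dist e2 a ->
       edge_dist e1 b = edge_dist e2 b -> e1 = e2} ->
  edge_metric_generator [set a; b].
Proof.
move=> sep; apply/edge_metric_generatorP => e1 e2 e1G e2G e12.
have [eq_a|neq_a] := eqVneq (edge_dist e1 a) (edge_dist e2 a); last first.
  by exists a; rewrite ?set21.
exists b; rewrite ?set22 //; apply: contraNneq e12 => eq_b.
by apply/eqP/sep.
Qed.

(** A vertex is at distance 1 from all its neighbours, so it cannot distinguish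
    two of them. *)
Lemma metric_generator1N v x y :
  adj v x -> adj v y -> x != y -> ~~ metric_generator [set v].
Proof.
move=> vx vy xy; apply/metric_generatorP => /(_ x y xy)[w /set1P->].
by rewrite !dist_adj ?eqxx.
Qed.

(** A vertex is at distance 0 from all its incident edges, so it cannot
    distinguish two of them. *)
Lemma edge_metric_generator1N v x y :
  adj v x -> adj v y -> x != y -> ~~ edge_metric_generator [set v].
Proof.
move=> vx vy xy; apply/edge_metric_generatorP.
move=> /(_ [set v; x] [set v; y] (mem_edges vx) (mem_edges vy)).
case=> [|w /set1P->]; last first.
  by rewrite !edge_dist_pair ?adj_neq // dist_refl !min0n.
apply: contraNneq xy => /setP/(_ x).
rewrite !inE eqxx orbT => /esym/predU1P[/esym eq_vx|//].
by rewrite eq_vx adj_irrefl in vx.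
Qed.

(** Monotonicity replaces a set with at most one element by a singleton that
    contains it, so no set satisfying [P] has fewer than two elements. *)
Lemma card_arg_min2 (P : pred {set G}) (a b : G) :
    (forall S T, S \subset T -> P S -> P T) ->
    P [set a; b] -> (forall v, ~~ P [set v]) ->
  #|[arg min_(S < [set: G] | P S) #|S|]| = 2.
Proof.
move=> monoP Pab P1N.
case: arg_minnP => [|S PS minS]; first exact: monoP (subsetT _) Pab.
apply/eqP; rewrite eqn_leq; apply/andP; split.
  by apply: leq_trans (minS _ Pab) _; rewrite cards2; case: (a != b).
rewrite ltnNge; apply/negP => S_le1.
have [v sSv] : exists v, S \subset [set v].
  have [->|[v vS]] := set_0Vmem S; first by exists a; apply: sub0set.
  exists v; apply/subsetP => w wS; rewrite inE.
  by rewrite (card_le1_eqP S_le1 _ _ wS vS).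
by have := P1N v; rewrite (monoP _ _ sSv PS).
Qed.

End Generators.

(** * Taxicab distance in the grid *)

(** The absolute difference: at least one summand is a truncated 0. *)
Definition gap (m n : nat) := (m - n) + (n - m).

Lemma gap_potential n (k : 'I_n) :
  @distance_potential (path_graph n) k (fun i : 'I_n => gap i k).
Proof.
split=> [|i j|i] /=; rewrite /gap.
- lia.
- by rewrite /path_adj => /orP[] /eqP; lia.
- move=> ik; have {}ik : i != k :> nat by [].
  have [lt_ki|le_ik] := ltnP k i.
    have lt_n : i.-1 < n by have := ltn_ord i; lia.
    by exists (Ordinal lt_n); rewrite /path_adj /=; lia.
  have lt_n : i.+1 < n by have := ltn_ord k; lia.
  by exists (Ordinal lt_n); rewrite /path_adj /= ?eqxx //; lia.
Qed.

(** An edge of the product moves along exactly one factor, so the Lipschitz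
    conditions pass to the sum; to descend, move along the first factor until
    it reaches [a], then along the second. *)
Lemma cart_potential (G H : sgraph) (a : G) (b : H) f g :
    distance_potential a f -> distance_potential b g ->
  @distance_potential (cart_prod G H) (a, b) (fun u : G * H => f u.1 + g u.2).
Proof.
case=> fa lipf descf [gb lipg descg]; split=> /= [|[x1 x2] [z1 z2]|[x1 x2]].
- by rewrite fa gb.
- rewrite /cart_adj /=.
  by case/orP=> /andP[/eqP-> ]; [move/lipg | move/lipf]; lia.
- have [->|/descf[z xz fz] _] := eqVneq x1 a; last first.
    by exists (z, x2); rewrite /cart_adj /= ?eqxx ?xz ?orbT // fz.
  have [->|/descg[z xz gz] _] := eqVneq x2 b; first by rewrite eqxx.
  by exists (a, z); rewrite /cart_adj /= ?eqxx ?xz // gz addnS.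
Qed.

Local Notation grid r t := (cart_prod (path_graph r) (path_graph t)).

Lemma grid_dist r t (u v : grid r t) :
  dist u v = gap u.1 v.1 + gap u.2 v.2.
Proof.
case: v => a b.
exact: dist_potential (cart_potential (gap_potential a) (gap_potential b)).
Qed.

(** * The generators of the grid *)

Lemma path_graph_neighbour n (i : path_graph n) :
  1 < n -> exists j, adj i j.
Proof.
move=> n_gt1; have [i0|i_gt0] := posnP (i : 'I_n).
  by exists (Ordinal n_gt1); rewrite /= /path_adj i0.
have lt_n : i.-1 < n by have := ltn_ord i; lia.
by exists (Ordinal lt_n); rewrite /= /path_adj /=; lia.
Qed.

Lemma grid_fork r t (v : grid r t) : 1 < r -> 1 < t ->
  exists x y, [/\ adj v x, adj v y & x != y].
Proof.
case: v => i j r_gt1 t_gt1.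
have [i' ii'] := path_graph_neighbour i r_gt1.
have [j' jj'] := path_graph_neighbour j t_gt1.
exists (i', j), (i, j'); split; first by apply/orP; right; apply/andP.
  by apply/orP; left; apply/andP.
by apply/eqP => -[eq_i _]; rewrite eq_i adj_irrefl in ii'.
Qed.

(** Orientation of the grid edges by increasing coordinates, which fixes the
    endpoint that is closest to each corner. *)
Definition edge_step m n (u v : 'I_m * 'I_n) :=
  v.1 = u.1.+1 :> nat /\ v.2 = u.2 :> nat \/
  v.1 = u.1 :> nat /\ v.2 = u.2.+1 :> nat.

Lemma grid_edgeP r t (e : {set grid r t}) : e \in edges (grid r t) ->
  exists u v : 'I_r * 'I_t, [/\ e = [set u; v], u != v & edge_step u v].
Proof.
case/imset2P=> u v _; rewrite inE => /andP[_ uv] ->.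
have neq_uv := adj_neq uv.
move: uv; rewrite /cart_adj /path_adj /=.
case/orP=> /andP[/eqP eq_c /orP[]/eqP eq_S].
- by exists u, v; rewrite /edge_step eq_c; split=> //; right.
- by exists v, u; rewrite /edge_step eq_c eq_sym setUC; split=> //; right.
- by exists u, v; rewrite /edge_step eq_c; split=> //; left.
- by exists v, u; rewrite /edge_step eq_c eq_sym setUC; split=> //; left.
Qed.

Lemma grid_vertex_eq r t (u v : 'I_r * 'I_t) :
  u.1 = v.1 :> nat -> u.2 = v.2 :> nat -> u = v.
Proof. by case: u v => [? ?] [? ?] /= /ord_inj-> /ord_inj->. Qed.

Lemma corner_dist r t (i : 'I_r.+1) (j : 'I_t.+1) :
  @dist (grid r.+1 t.+1) (i, j) (ord0, ord0) = i + j /\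
  @dist (grid r.+1 t.+1) (i, j) (ord0, ord_max) = i + (t - j).
Proof. by rewrite !grid_dist /gap /=; case: j => j lt_j /=; split; lia. Qed.

Lemma grid_distC r t (u v : grid r t) : dist u v = dist v u.
Proof. by rewrite !grid_dist /gap; congr (_ + _); apply: addnC. Qed.

(** The vertex [u] is an endpoint closest to (0, 0), and [v.2] is the larger
    second coordinate. A step in the first coordinate has [u.2 = v.2] and [u]
    closest to (0, t); a step in the second has [u.1 = v.1] and [v] closest to
    (0, t). Both cases thus share one formula. *)
Lemma corner_edge_dist r t (u v : 'I_r.+1 * 'I_t.+1) :
    u != v -> edge_step u v ->
  @edge_dist (grid r.+1 t.+1) [set u; v] (ord0, ord0) = u.1 + u.2 /\
  @edge_dist (grid r.+1 t.+1) [set u; v] (ord0, ord_max) = u.1 + (t - v.2).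
Proof.
case: u v => [i j] [k l] uv; rewrite !(@edge_dist_pair (grid _ _)) //.
have [-> ->] := corner_dist i j; have [-> ->] := corner_dist k l.
by rewrite /edge_step /=; case=> -[-> ->]; lia.
Qed.

Lemma grid_corners_metric r t :
  @metric_generator (grid r.+1 t.+1) [set (ord0, ord0); (ord0, ord_max)].
Proof.
apply: metric_generator_pair => -[i j] [k l].
rewrite !(grid_distC (_, _) (i, j)) !(grid_distC (_, _) (k, l)).
have [-> ->] := corner_dist i j; have [-> ->] := corner_dist k l => eq0 eqm.
by apply: grid_vertex_eq => /=; have := ltn_ord j; have := ltn_ord l; lia.
Qed.

(** If the two edges had different directions, adding the two distance
    equations would equate numbers of opposite parity; in equal directions
    the equations determine the coordinates as they do for vertices. *)
Lemma grid_corners_edge_metric r t :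
  @edge_metric_generator (grid r.+1 t.+1) [set (ord0, ord0); (ord0, ord_max)].
Proof.
apply: edge_metric_generator_pair => e e'.
move=> /grid_edgeP[u [v [-> uv dir]]] /grid_edgeP[u' [v' [-> uv' dir']]].
have [-> ->] := corner_edge_dist uv dir.
have [-> ->] := corner_edge_dist uv' dir' => eq0 eqm.
suff [-> ->] : u = u' /\ v = v' by [].
have := ltn_ord v.2; have := ltn_ord v'.2 => ? ?.
by case: dir dir' => -[? ?] [] -[? ?]; split; apply: grid_vertex_eq; lia.
Qed.

Theorem proposition4 (r t : nat) (hrt : t <= r) (ht : 2 <= t) :
  edge_metric_dim (cart_prod (path_graph r) (path_graph t)) = 2 /\
  metric_dim (cart_prod (path_graph r) (path_graph t)) = 2.
Proof.
have hr := leq_trans ht hrt.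
case: r t {hrt} ht hr => [|r] [|t] // ht hr; split.
- apply: card_arg_min2 (@edge_metric_generatorS _)
    (grid_corners_edge_metric r t) _ => v.
  by have [x [y [vx vy]]] := grid_fork v hr ht; apply: edge_metric_generator1N.
- apply: card_arg_min2 (@metric_generatorS _) (grid_corners_metric r t) _ => v.
  by have [x [y [vx vy]]] := grid_fork v hr ht; apply: metric_generator1N.
Qed.
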